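(* Let $G=(V,E)$ be a finite simple graph and let $T: G \to G$ be a graph endomorphism. Let $\mathcal{F}(T)$ be the set of simplices $x$ of $G$ with $T(x)=x$. Then $$ L(T) = \sum_{x \in \mathcal{F}(T)} i_T(x) . $$
   Context: For a finite simple graph $G=(V,E)$, let $\mathcal{G}_k$ be the set of complete subgraphs $K_{k+1}$ of $G$ (identified with their vertex sets); its elements are called $k$-simplices (cliques) of dimension $\dim(x)=k$, and $\mathcal{G}=\bigcup_k \mathcal{G}_k$ is the set of all simplices. The empty set is not a simplex. A $k$-form is a real-valued function $f(x_0,\dots,x_k)$ on ordered $k$-simplices that is antisymmetric in its $k+1$ arguments; $\Omega^k$ is the vector space of $k$-forms. The exterior derivative $d:\Omega^k\to\Omega^{k+1}$ is $df(x_0,\dots,x_{k+1})=\sum_i (-1)^i f(x_0,\dots,\hat{x_i},\dots,x_{k+1})$. The cohomology group $H^k(G)$ is the real vector space of closed $k$-forms ($df=0$) modulo exact $k$-forms ($f=dg$). A graph endomorphism $T$ of $G$ is a map $T:V\to V$ such that $(a,b)\in E$ implies $(T(a),T(b))\in E$. It maps simplices to simplices of the same dimension, and it induces a linear map $T_k: H^k(G)\to H^k(G)$ by pull-back, $f(x_0,\dots,x_k)\mapsto f(T(x_0),\dots,T(x_k))$. The Lefschetz number is $L(T)=\sum_{k\ge 0}(-1)^k \mathrm{tr}(T_k)$. A simplex $x$ is fixed by $T$ if $T(x)=x$ as a set; then $T|x$ is a permutation of the vertices of $x$, and the index is $i_T(x)=(-1)^{\dim(x)}\,\mathrm{sign}(T|x)$,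 where $\mathrm{sign}(T|x)\in\{-1,1\}$ is the signature of that permutation. *)

(* Defs.v *)
From HB Require Import structures.
From mathcomp Require Import all_boot all_order all_algebra all_fingroup.
From mathcomp Require Import generic_quotient ring_quotient.

Set Implicit Arguments.
Unset Strict Implicit.
Unset Printing Implicit Defensive.

Import GRing.Theory.
Local Open Scope ring_scope.
Local Open Scope quotient_scope.

(* MathComp has the quotient of a Z-module by a subgroup, but not the quotient
   of a vector space by a subspace: scaling and finite dimension are added
   to [Quotient.quot] here. *)
Section QuotientSpace.
Variables (F : fieldType) (vT : vectType F) (B : {vspace vT}).

Definition quotv : Type := Quotient.quot (pred_of_vspace B).

HB.instance Definition _ := GRing.Zmodule.on quotv.

Definition quotv_pi (x : vT) : quotv := \pi_(Quotient.quot (pred_of_vspace B)) x.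

Definition quotv_repr (u : quotv) : vT :=
  repr (u : Quotient.quot (pred_of_vspace B)).

Lemma quotv_reprK : cancel quotv_repr quotv_pi.
Proof. exact: reprK. Qed.

Lemma eq_quotv x y : (quotv_pi x == quotv_pi y) = (x - y \in B).
Proof. by rewrite (Quotient.idealrBE (pred_of_vspace B)). Qed.

Lemma quotv_piD : {morph quotv_pi : x y / x + y}.
Proof. by move=> x y; rewrite /quotv_pi; apply: (Quotient.pi_add (pred_of_vspace B)). Qed.

Lemma quotv_repr_pi x : quotv_repr (quotv_pi x) - x \in B.
Proof. by rewrite -eq_quotv quotv_reprK. Qed.

Definition quotv_scale (a : F) (u : quotv) : quotv :=
  quotv_pi (a *: quotv_repr u).

Lemma quotv_piZ a x : quotv_scale a (quotv_pi x) = quotv_pi (a *: x).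
Proof.
by apply/eqP; rewrite /quotv_scale eq_quotv -scalerBr rpredZ ?quotv_repr_pi.
Qed.

Fact quotv_scaleA a b u :
  quotv_scale a (quotv_scale b u) = quotv_scale (a * b) u.
Proof. by rewrite -[u]quotv_reprK !quotv_piZ scalerA. Qed.

Fact quotv_scale1 : left_id 1 quotv_scale.
Proof. by move=> u; rewrite -[u]quotv_reprK quotv_piZ scale1r. Qed.

Fact quotv_scaleDr : right_distributive quotv_scale +%R.
Proof.
move=> a u v; rewrite -[u]quotv_reprK -[v]quotv_reprK.
by rewrite -quotv_piD !quotv_piZ -quotv_piD scalerDr.
Qed.

Fact quotv_scaleDl u : {morph quotv_scale^~ u : a b / a + b}.
Proof.
by move=> a b; rewrite -[u]quotv_reprK !quotv_piZ -quotv_piD scalerDl.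
Qed.

HB.instance Definition _ := GRing.Zmodule_isLmodule.Build F quotv
  quotv_scaleA quotv_scale1 quotv_scaleDr quotv_scaleDl.

Lemma quotv_pi_linear : linear quotv_pi.
Proof. by move=> a x y; rewrite quotv_piD -quotv_piZ. Qed.

HB.instance Definition _ := GRing.isSemilinear.Build F vT quotv _ quotv_pi
  (GRing.semilinear_linear quotv_pi_linear).

Let p : 'End(vT) := (\1 - projv B)%VF.

Let pE x : p x = x - projv B x.
Proof. by rewrite !lfunE /= !lfunE. Qed.

Let p0 x : x \in B -> p x = 0.
Proof. by move=> xB; rewrite pE projv_id // subrr. Qed.

Let pp x : p (p x) = p x.
Proof. by rewrite [in LHS](pE x) linearB /= (p0 (memv_proj _ _)) subr0. Qed.

Let p_repr x : p (quotv_repr (quotv_pi x)) = p x.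
Proof. by apply/eqP; rewrite -subr_eq0 -linearB /= p0 ?quotv_repr_pi. Qed.

Fact quotv_vect_iso : Vector.axiom (\dim (limg p)) quotv.
Proof.
exists (fun u => \row_i coord (vbasis (limg p)) i (p (quotv_repr u))).
  move=> a u v; rewrite -[u]quotv_reprK -[v]quotv_reprK -quotv_pi_linear !p_repr.
  by apply/rowP => i; rewrite !mxE (linearP p) linearP.
exists (fun r : 'rV_(\dim (limg p)) =>
          quotv_pi (\sum_i r 0 i *: (vbasis (limg p))`_i)).
  move=> u; rewrite -[RHS]quotv_reprK; apply/eqP; rewrite eq_quotv.
  under eq_bigr do rewrite mxE.
  rewrite -(coord_vbasis (memv_img _ (memvf _))) pE.
  by rewrite addrAC subrr add0r rpredN memv_proj.
move=> r; rewrite p_repr; apply/rowP => i; rewrite mxE.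
set x := \sum_i _.
have /memv_imgP [y _ xE] : x \in limg p.
  by apply: rpred_sum => j _; rewrite rpredZ ?vbasis_mem ?memt_nth.
by rewrite xE pp -xE coord_sum_free ?(basis_free (vbasisP _)).
Qed.

HB.instance Definition _ := Lmodule_hasFinDim.Build F quotv quotv_vect_iso.

End QuotientSpace.

Arguments quotv {F vT} B.
Arguments quotv_pi {F vT} B x.

Definition lftrace (F : fieldType) (vT : vectType F) (phi : 'End(vT)) : F :=
  \tr (passmx.mxof (vbasis {:vT}) (vbasis {:vT}) phi).

Record sgraph := SGraph {
  vertex :> finType;
  adj : rel vertex;
  adj_sym : symmetric adj;
  adj_irr : irreflexive adj }.

Arguments adj {s} _ _.

Record endo (G : sgraph) := Endo {
  endo_fun :> G -> G;
  endoP : forall a b : G, adj a b -> adj (endo_fun a) (endo_fun b) }.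

Section Graph.
Variable G : sgraph.

Definition is_simplex (x : {set G}) : bool :=
  (x != set0) && [forall a in x, forall b in x, (a != b) ==> adj a b].

Definition sdim (x : {set G}) : nat := #|x|.-1.

Definition is_osimplex k (x : {ffun 'I_k.+1 -> G}) : bool :=
  [forall i, forall j, (i != j) ==> adj (x i) (x j)].

Definition osimplex k := {x : {ffun 'I_k.+1 -> G} | is_osimplex x}.

Fact osimplex_comp_subproof m k (h : 'I_m.+1 -> 'I_k.+1) (x : osimplex k) :
  injective h -> is_osimplex [ffun i => val x (h i)].
Proof.
move=> h_inj; apply/'forall_'forall_implyP => i j ij; rewrite !ffunE.
have /'forall_'forall_implyP := valP x; apply.
by rewrite (inj_eq h_inj).
Qed.

(* (x_{s 0}, ..., x_{s k}) *)
Definition osimplex_perm k (s : 'S_k.+1) (x : osimplex k) : osimplex k :=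
  Sub _ (osimplex_comp_subproof x (@perm_inj _ s)).

(* (x_0, ..., x_{i-1}, x_{i+1}, ..., x_{k+1}) *)
Definition face k (i : 'I_k.+2) (x : osimplex k.+1) : osimplex k :=
  Sub _ (osimplex_comp_subproof x (@lift_inj _ i)).

Fact osimplex_map_subproof (T : endo G) k (x : osimplex k) :
  is_osimplex [ffun i => T (val x i)].
Proof.
apply/'forall_'forall_implyP => i j ij; rewrite !ffunE; apply: endoP.
by have /'forall_'forall_implyP := valP x; apply.
Qed.

Definition osimplex_map (T : endo G) k (x : osimplex k) : osimplex k :=
  Sub _ (osimplex_map_subproof T x).

End Graph.

Section Cohomology.
Variables (F : fieldType) (G : sgraph).

(* [F^o] is [F] seen as a one-dimensional vector space over itself. *)
Definition cochain k : vectType F := {ffun osimplex G k -> F^o}.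

Definition antisymmetric k (f : cochain k) : Prop :=
  forall (i j : 'I_k.+1) (x : osimplex G k),
    i != j -> f (osimplex_perm (tperm i j) x) = - f x.

Definition swap_add k (i j : 'I_k.+1) (f : cochain k) : cochain k :=
  [ffun x => f (osimplex_perm (tperm i j) x) + f x].

Fact swap_add_linear k (i j : 'I_k.+1) : linear (@swap_add k i j).
Proof.
move=> a f g; apply/ffunP => x; rewrite !ffunE /= scalerDr.
by rewrite addrACA.
Qed.

HB.instance Definition _ k i j := GRing.isSemilinear.Build F _ _ _
  (@swap_add k i j) (GRing.semilinear_linear (@swap_add_linear k i j)).

Definition antisym_space k : {vspace cochain k} :=
  (\bigcap_(ij : 'I_k.+1 * 'I_k.+1 | ij.1 != ij.2)
     lker (linfun (swap_add ij.1 ij.2)))%VS.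

Lemma antisym_spaceP k (f : cochain k) :
  reflect (antisymmetric f) (f \in antisym_space k).
Proof.
apply: (iffP idP) => [fA i j x ij | fA].
  have sAk : (antisym_space k <= lker (linfun (@swap_add k i j)))%VS.
    exact: (bigcapv_inf (i, j)).
  move/subvP/(_ f fA): sAk.
  rewrite memv_ker lfunE /= => /eqP/ffunP/(_ x).
  by rewrite !ffunE => /eqP; rewrite addr_eq0 => /eqP.
rewrite memvE; apply/subv_bigcapP => -[i j] /= ij.
rewrite -memvE memv_ker lfunE /=; apply/eqP/ffunP => x.
by rewrite !ffunE fA // addNr.
Qed.

Definition kform k : vectType F := subvs_of (antisym_space k).

Lemma antisym_perm k (f : cochain k) (s : 'S_k.+1) x :
  f \in antisym_space k -> f (osimplex_perm s x) = (-1) ^+ s * f x.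
Proof.
move=> /antisym_spaceP fA.
have [ts -> ts_dpair] := prod_tpermP s.
elim: ts ts_dpair x => [|t ts IHts] /= => [_ x | /andP[tD tsD] x].
  rewrite big_nil odd_perm1 mul1r; congr (f _); apply/val_inj/ffunP => i.
  by rewrite !ffunE perm1.
rewrite big_cons odd_permM odd_tperm tD signr_addb expr1 -mulrA -IHts //.
rewrite mulN1r -(fA t.1 t.2) //; congr (f _); apply/val_inj/ffunP => i.
by rewrite !ffunE permM.
Qed.

Definition dcochain k (f : cochain k) : cochain k.+1 :=
  [ffun x => \sum_(i < k.+2) (-1) ^+ i * f (face i x)].

Fact dcochain_linear k : linear (@dcochain k).
Proof.
move=> a f g; apply/ffunP => x; rewrite !ffunE scaler_sumr -big_split /=.
apply: eq_bigr => i _; rewrite !ffunE mulrDr; congr (_ + _).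
by rewrite -[LHS]/(_ * (a * _)) mulrCA.
Qed.

HB.instance Definition _ k := GRing.isSemilinear.Build F _ _ _
  (@dcochain k) (GRing.semilinear_linear (@dcochain_linear k)).

Lemma dcochain_antisym k (f : cochain k) :
  f \in antisym_space k -> dcochain f \in antisym_space k.+1.
Proof.
move=> fA; apply/antisym_spaceP => a b x ab.
rewrite !ffunE -sumrN [RHS](reindex_inj (@perm_inj _ (tperm a b))) /=.
apply: eq_bigr => i _; set s := tperm a b.
have fs (t : 'S_k.+2) u v (tuv : t u = v) :
    exists t' : 'S_k.+1, t = lift_perm u v t'.
  have inj_h : injective (fun j => odflt j (unlift v (t (lift u j)))).
    move=> j j' /=; have uj l : v != t (lift u l).
      by rewrite -tuv (inj_eq perm_inj) neq_lift.
    case: (unlift_some (uj j)) => l lE ->.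
    case: (unlift_some (uj j')) => l' lE' -> /= ll'.
    by move: lE; rewrite ll' -lE' => /perm_inj/lift_inj.
  exists (perm inj_h); apply/permP => j.
  case: (unliftP u j) => [l ->|->]; last by rewrite lift_perm_id.
  rewrite lift_perm_lift [RHS]/= permE /=.
  have : v != t (lift u l) by rewrite -tuv (inj_eq perm_inj) neq_lift.
  by case/unlift_some => l' lE ->.
have [s' sE] := fs s i (s i) (erefl _).
have -> : face i (osimplex_perm s x) = osimplex_perm s' (face (s i) x).
  apply/val_inj/ffunP => j; rewrite !ffunE; congr (val x _).
  by rewrite [in LHS]sE lift_perm_lift.
rewrite antisym_perm // mulrA -mulNr; congr (_ * _).
have := congr1 (@odd_perm _) sE; rewrite odd_tperm ab odd_lift_perm => sgE.
rewrite -[(-1) ^+ i]signr_odd -[(-1) ^+ s i]signr_odd.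
by case: (odd i) sgE; case: (odd (s i)); case: (odd_perm s') => //= _;
  rewrite !(expr0, expr1, mulr1, mul1r, mulrNN, opprK).
Qed.

Definition dform k (f : kform k) : kform k.+1 :=
  Subvs (dcochain_antisym (subvsP f)).

Fact dform_linear k : linear (@dform k).
Proof. by move=> a f g; apply/val_inj; rewrite /= !linearP. Qed.

HB.instance Definition _ k := GRing.isSemilinear.Build F _ _ _
  (@dform k) (GRing.semilinear_linear (@dform_linear k)).

Definition closed_form k : {vspace kform k} := lker (linfun (@dform k)).

(* There are no forms of degree -1, so 0 is the only exact 0-form. *)
Definition exact_form k : {vspace kform k} :=
  match k with
  | 0 => 0%VS
  | k'.+1 => limg (linfun (@dform k'))
  end.

Definition exact_in_closed k : {vspace subvs_of (closed_form k)} :=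
  (linfun vsval @^-1: exact_form k)%VS.

Definition cohomology k : vectType F := quotv (exact_in_closed k).

Definition cohomology_class k (f : subvs_of (closed_form k)) : cohomology k :=
  quotv_pi (exact_in_closed k) f.

End Cohomology.

Arguments cohomology_class {F G k} f.

Section Lefschetz.
Variables (F : fieldType) (G : sgraph) (T : endo G).

Definition pull_cochain k (f : cochain F G k) : cochain F G k :=
  [ffun x => f (osimplex_map T x)].

Lemma pull_cochain_antisym k (f : cochain F G k) :
  f \in antisym_space F G k -> pull_cochain f \in antisym_space F G k.
Proof.
move=> /antisym_spaceP fA; apply/antisym_spaceP => i j x ij.
rewrite !ffunE -(fA i j) //; congr (f _); apply/val_inj/ffunP => l.
by rewrite !ffunE.
Qed.

Definition pull_form k (f : kform F G k) : kform F G k :=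
  Subvs (pull_cochain_antisym (subvsP f)).

Fact pull_form_linear k : linear (@pull_form k).
Proof.
by move=> a f g; apply/val_inj/ffunP => x; rewrite /= !ffunE.
Qed.

HB.instance Definition _ k := GRing.isSemilinear.Build F _ _ _
  (@pull_form k) (GRing.semilinear_linear (@pull_form_linear k)).

Lemma pull_dform k (f : kform F G k) : pull_form (dform f) = dform (pull_form f).
Proof.
apply/val_inj/ffunP => x; rewrite /= !ffunE; apply: eq_bigr => i _.
rewrite !ffunE; congr (_ * val f _); apply/val_inj/ffunP => j.
by rewrite !ffunE.
Qed.

Lemma pull_closed k (f : kform F G k) :
  f \in closed_form F G k -> pull_form f \in closed_form F G k.
Proof. by rewrite !memv_ker !lfunE /= -pull_dform => /eqP->; rewrite linear0. Qed.

Lemma pull_exact k (f : kform F G k) :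
  f \in exact_form F G k -> pull_form f \in exact_form F G k.
Proof.
case: k f => [|k] f /=; first by rewrite !memv0 => /eqP->; rewrite linear0.
case/memv_imgP => g _ ->; rewrite lfunE /= pull_dform.
by apply/memv_imgP; exists (pull_form g); rewrite ?memvf ?lfunE.
Qed.

Definition pull_closed_form k (f : subvs_of (closed_form F G k)) :
  subvs_of (closed_form F G k) := Subvs (pull_closed (subvsP f)).

Definition pull_class k (u : cohomology F G k) : cohomology F G k :=
  cohomology_class (pull_closed_form (quotv_repr u)).

Lemma pull_classE k (f : subvs_of (closed_form F G k)) :
  pull_class (cohomology_class f) = cohomology_class (pull_closed_form f).
Proof.
apply/eqP; rewrite eq_quotv -memv_preim lfunE /= -linearB /=.
apply: pull_exact; rewrite -[_ - _]/(vsval (quotv_repr (cohomology_class f) - f)).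
by have := quotv_repr_pi (exact_in_closed F G k) f; rewrite -memv_preim lfunE.
Qed.

Fact pull_class_linear k : linear (@pull_class k).
Proof.
move=> a u v; rewrite -[u]quotv_reprK -[v]quotv_reprK -linearP /=.
rewrite !pull_classE -linearP /=; congr (quotv_pi _ _).
by apply/val_inj; rewrite /= linearP.
Qed.

HB.instance Definition _ k := GRing.isSemilinear.Build F _ _ _
  (@pull_class k) (GRing.semilinear_linear (@pull_class_linear k)).

Definition induced k : 'End(cohomology F G k) := linfun (@pull_class k).

(* The sum over all k >= 0; by [lftrace_induced_eq0] the terms with
   k >= #|G| vanish. *)
Definition lefschetz : F := \sum_(k < #|G|) (-1) ^+ k * lftrace (induced k).

Lemma lftrace_induced_eq0 k : (#|G| <= k)%N -> lftrace (induced k) = 0.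
Proof.
move=> leGk.
have noS (x : osimplex G k) : False.
  have x_inj : injective (val x).
    move=> i j xij; apply/eqP; apply/negPn/negP => ij.
    have /'forall_'forall_implyP/(_ i j ij) := valP x.
    by rewrite xij adj_irr.
  by have := leq_card _ x_inj; rewrite card_ord ltnNge leGk.
have all0 (u : cohomology F G k) : u = 0.
  rewrite -[u]quotv_reprK; set f := quotv_repr u.
  suff -> : f = 0 by rewrite linear0.
  by apply/val_inj/val_inj/ffunP => x; case: (noS x).
have dim0 : \dim {:cohomology F G k} = 0%N.
  apply/eqP; rewrite dimv_eq0; apply/eqP/vspaceP => u.
  by rewrite (all0 u) !mem0v.
rewrite /lftrace /mxtrace big1 // => i _; have := ltn_ord i.
by rewrite [X in (_ < X)%N]dim0.
Qed.

End Lefschetz.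

Section Index.
Variables (G : sgraph) (T : endo G).

Definition fixed_simplices : {set {set G}} :=
  [set x : {set G} | is_simplex x && (T @: x == x)].

Definition simplex_fun (x : {set G}) (v : {v : G | v \in x}) : {v : G | v \in x} :=
  insubd v (T (val v)).

(* The permutation T|x of the vertices of x, for x such that T(x) = x
   (see [simplex_permE]). The default value 1 is used only when T(x) <> x. *)
Definition simplex_perm (x : {set G}) : {perm {v : G | v \in x}} :=
  insubd (1%g : {perm {v : G | v \in x}}) (finfun (@simplex_fun x)).

Lemma simplex_permE (x : {set G}) (v : {v : G | v \in x}) :
  T @: x = x -> val (simplex_perm x v) = T (val v).
Proof.
move=> Tx.
have Tin w : w \in x -> T w \in x by rewrite -{2}Tx; apply: imset_f.
have funE w : val (@simplex_fun x w) = T (val w).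
  by rewrite /simplex_fun val_insubd Tin // (valP w).
have T_inj : {in x &, injective T} by apply/imset_injP; rewrite Tx.
have f_inj : injectiveb (finfun (@simplex_fun x)).
  apply/injectiveP => u w; rewrite !ffunE => /(congr1 val).
  rewrite !funE => /T_inj E; apply: val_inj; apply: E; exact: valP.
by rewrite -funE /simplex_perm -pvalE -[pval _]/(val _) val_insubd f_inj ffunE.
Qed.

Definition fixed_index (x : {set G}) : int :=
  (-1) ^+ sdim x * (-1) ^+ odd_perm (simplex_perm x).

End Index.

(* Main.v *)
From HB Require Import structures.
Require Import Defs.
From mathcomp Require Import all_boot all_order all_algebra all_fingroup.
From mathcomp Require Import reals.

(** Both sides of the Lefschetz formula are computed on the finite dimensional
    complex of forms, before passing to cohomology.

    The first half is the Hopf trace formula.  A trace is additive along a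
    short exact sequence of spaces with compatible endomorphisms
    ([lftrace_exact]).  Writing C, Z, B and H for the forms, closed forms,
    exact forms and cohomology, the sequences Z^k -> C^k -> B^(k+1), with
    second map the exterior derivative, and B^k -> Z^k -> H^k give
    [tr C^k = tr B^k + tr H^k + tr B^(k+1)] ([lftrace_form] and
    [lftrace_closed]).  In the alternating sum over k the traces on exact
    forms telescope, since B^0 = 0 and there are no forms in degree #|G|, so
    the Lefschetz number is the alternating sum of the traces of the pull-back
    on forms ([lefschetz_forms]).

    The second half computes the trace on k-forms ([lftrace_pull_form]).  In
    characteristic 0 the k-forms are the image of the alternation projector
    [alternate] on all functions of ordered k-simplices, so the trace can be
    read off the basis of delta functions: it is the sum over the ordered
    simplices x, divided by (k+1)!, of the signs of the reorderings s such
    that T(x) permuted by s is x.  Such an s exists exactly when T fixes the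
    vertex set of x; it is then unique, and its sign is that of T restricted
    to this set ([sum_perm_fixed]).  As each simplex of dimension k has (k+1)!
    orderings ([card_osimplex_vset]), what remains is the sum of the signs of
    T on the fixed simplices of dimension k. *)

Set Implicit Arguments.
Unset Strict Implicit.
Unset Printing Implicit Defensive.

Import GRing.Theory.
Local Open Scope ring_scope.

(** * Traces of endomorphisms *)

Section Trace.
Variable F : fieldType.
Implicit Types U V W : vectType F.

Lemma lftrace_comp U V (f : 'Hom(U, V)) (g : 'Hom(V, U)) :
  lftrace (f \o g)%VF = lftrace (g \o f)%VF.
Proof.
rewrite /lftrace (passmx.mxof_comp _ _ (vbasisP {:U})).
by rewrite (passmx.mxof_comp _ _ (vbasisP {:V})) mxtrace_mulC.
Qed.

Lemma lftrace_is_linear V : linear (@lftrace F V : 'End(V) -> F^o).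
Proof.
by move=> a f g; rewrite /lftrace passmx.mxof_linear mxtraceD mxtraceZ.
Qed.

HB.instance Definition _ V := GRing.isSemilinear.Build F 'End(V) F^o _
  (@lftrace F V : 'End(V) -> F^o)
  (GRing.semilinear_linear (@lftrace_is_linear V)).

Lemma lftrace_id V : lftrace (\1%VF : 'End(V)) = (\dim {:V})%:R.
Proof.
by rewrite /lftrace passmx.mxof1 ?mxtrace1 // (basis_free (vbasisP _)).
Qed.

Lemma lftrace_trivial (V : vectType F) (phi : 'End(V)) :
  (forall v : V, v = 0) -> lftrace phi = 0.
Proof.
move=> V0; rewrite (_ : phi = 0) ?linear0 //.
by apply/lfunP => v; rewrite (V0 v) linear0 lfunE.
Qed.

Lemma lker_vsval (V : vectType F) (U : {vspace V}) :
  lker (linfun (@vsval F V U)) = 0%VS.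
Proof. by apply/eqP/lker0P => u v; rewrite !lfunE => /val_inj. Qed.

Lemma limg_vsval (V : vectType F) (U : {vspace V}) :
  limg (linfun (@vsval F V U)) = U.
Proof.
apply/vspaceP => v; apply/memv_imgP/idP => [[u _ ->]|vU].
  by rewrite lfunE subvsP.
by exists (Subvs vU); rewrite ?memvf ?lfunE.
Qed.

(** Additivity of the trace along the exact sequence 0 -> U -> V -> W -> 0:
    a section s of p and a retraction r of i with i r + s p = 1 split b into
    b i r and b s p, and [lftrace_comp] moves the traces to U and W. *)
Lemma lftrace_exact U V W (i : 'Hom(U, V)) (p : 'Hom(V, W))
    (a : 'End(U)) (b : 'End(V)) (c : 'End(W)) :
  lker i = 0%VS -> limg p = fullv -> lker p = limg i ->
  (b \o i = i \o a)%VF -> (p \o b = c \o p)%VF ->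
  lftrace b = lftrace a + lftrace c.
Proof.
move=> ker_i img_p ker_p bi pb.
(* The retraction inverts i on v - s (p v), which lies in the kernel of p. *)
pose s := (p^-1)%VF; pose r := (i^-1 \o (\1 - (s \o p)))%VF.
have ps : (p \o s = \1)%VF.
  by apply/lfunP => w; rewrite !lfun_simp /= limg_lfunVK // img_p memvf.
have pi0 : (p \o i = 0)%VF.
  apply/lfunP => u; rewrite !lfun_simp /=; apply/eqP.
  by rewrite -memv_ker ker_p memv_img ?memvf.
have ri : (r \o i = \1)%VF.
  rewrite /r -comp_lfunA comp_lfunDl comp_lfunNl -comp_lfunA pi0 comp_lfun0r.
  by rewrite subr0 comp_lfun1l lker0_compVf // ker_i.
have irsp : ((i \o r) + (s \o p) = \1)%VF.
  apply/lfunP => v; rewrite !lfun_simp /= limg_lfunVK ?subrK //.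
  rewrite -ker_p memv_ker linearB /= -[p (s _)]comp_lfunE ps !lfun_simp /=.
  by rewrite subrr.
clearbody r s.
rewrite -[b in LHS]comp_lfun1r -irsp comp_lfunDr linearD /= !comp_lfunA.
rewrite [X in X + _]lftrace_comp [X in _ + X]lftrace_comp.
by rewrite bi comp_lfunA ri comp_lfun1l comp_lfunA pb -comp_lfunA ps comp_lfun1r.
Qed.

(** The function with value c at x and 0 elsewhere. *)
Definition delta_ffun (X : finType) (x : X) (c : F^o) : {ffun X -> F^o} :=
  [ffun y => if y == x then c else 0].

Fact delta_ffun_is_linear (X : finType) (x : X) : linear (@delta_ffun X x).
Proof.
move=> a c d; apply/ffunP => y; rewrite !ffunE.
by case: eqP; rewrite ?scaler0 ?addr0.
Qed.

HB.instance Definition _ (X : finType) (x : X) :=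
  GRing.isSemilinear.Build F F^o _ _
  (@delta_ffun X x) (GRing.semilinear_linear (@delta_ffun_is_linear X x)).

(** Evaluation at x, as a map to the one-dimensional space [F^o]. *)
Definition eval_ffun (X : finType) (x : X) (f : {ffun X -> F^o}) : F^o := f x.

Fact eval_ffun_is_linear (X : finType) (x : X) : linear (@eval_ffun X x).
Proof. by move=> a f g; rewrite /eval_ffun !ffunE. Qed.

HB.instance Definition _ (X : finType) (x : X) :=
  GRing.isSemilinear.Build F {ffun X -> F^o} F^o _
  (@eval_ffun X x) (GRing.semilinear_linear (@eval_ffun_is_linear X x)).

(** The trace on the space of functions on X is the sum of the diagonal
    coefficients in the basis of delta functions: the identity is the sum of
    the rank one maps f |-> f x * delta_x. *)
Lemma lftrace_ffun (X : finType) (phi : 'End({ffun X -> F^o})) :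
  lftrace phi = \sum_x (phi (delta_ffun x 1) x : F).
Proof.
pose E x := (linfun (@delta_ffun X x) \o linfun (@eval_ffun X x))%VF.
have id_sum : \sum_x E x = \1%VF.
  apply/lfunP => f; apply/ffunP => y; rewrite !lfun_simp /=.
  rewrite sum_ffunE (bigD1 y) //=.
  rewrite big1 => [|x xy]; rewrite !lfun_simp /= ffunE ?eqxx ?addr0 //.
  by rewrite eq_sym (negbTE xy).
rewrite -[phi in LHS]comp_lfun1r -id_sum.
have -> : (phi \o \sum_x E x)%VF = \sum_x (phi \o E x)%VF.
  apply/lfunP => f; rewrite !lfun_simp /= linear_sum.
  by apply: eq_bigr => x _; rewrite !lfun_simp.
rewrite linear_sum; apply: eq_bigr => x _ /=.
rewrite comp_lfunA lftrace_comp.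
set t := (X in lftrace X).
have -> : t = phi (delta_ffun x 1) x *: \1%VF.
  apply/lfunP => c; rewrite !lfun_simp /=.
  have -> : delta_ffun x c = c *: delta_ffun x 1.
    by rewrite -linearZ /= /GRing.scale /= mulr1.
  by rewrite linearZ /= /eval_ffun ffunE /GRing.scale /= mulrC.
by rewrite linearZ /= lftrace_id dimvf /GRing.scale /= mulr1.
Qed.

End Trace.

(** * Ordered simplices and fixed simplices *)

Section PermTransport.

(** Transporting a permutation along a bijection preserves its parity. *)
Lemma perm_transport (S T : finType) (f : S -> T) (s : {perm T}) :
  bijective f ->
  exists2 t : {perm S}, (forall i, f (t i) = s (f i)) & odd_perm t = odd_perm s.
Proof.
move=> bij_f; have inj_f := bij_inj bij_f; have [g fK gK] := bij_f.
have [ts -> _] := prod_tpermP s.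
elim: ts => [|[a b] ts [t tE t_odd]].
  by rewrite big_nil; exists 1%g; rewrite ?odd_perm1 // => i; rewrite !perm1.
rewrite big_cons /=; exists (tperm (g a) (g b) * t)%g => [i|]; last first.
  by rewrite !odd_mul_tperm t_odd (inj_eq (can_inj gK)).
by rewrite !permM tE -[a in RHS]gK -[b in RHS]gK inj_tperm.
Qed.

End PermTransport.

Section OrientedSimplices.
Variable G : sgraph.

Lemma osimplex_inj k (x : osimplex G k) : injective (val x).
Proof.
move=> i j xij; apply/eqP/negPn/negP => ij.
have /'forall_'forall_implyP/(_ i j ij) := valP x.
by rewrite xij adj_irr.
Qed.

(** The underlying set of vertices of an ordered simplex. *)
Definition vset k (x : osimplex G k) : {set G} := [set val x i | i in 'I_k.+1].

Lemma card_vset k (x : osimplex G k) : #|vset x| = k.+1.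
Proof. by rewrite card_imset ?card_ord //; apply: osimplex_inj. Qed.

Lemma osimplex_dim k (x : osimplex G k) : (k < #|G|)%N.
Proof. by rewrite -(card_vset x) max_card. Qed.

Lemma vset_simplex k (x : osimplex G k) : is_simplex (vset x).
Proof.
apply/andP; split; first by rewrite -card_gt0 card_vset.
apply/'forall_implyP => _ /imsetP[i _ ->].
apply/'forall_implyP => _ /imsetP[j _ ->].
apply/implyP => xij; have /'forall_'forall_implyP := valP x; apply.
by apply: contraNneq xij => ->.
Qed.

Lemma osimplex_permM k (s t : 'S_k.+1) (x : osimplex G k) :
  osimplex_perm s (osimplex_perm t x) = osimplex_perm (s * t)%g x.
Proof. by apply/val_inj/ffunP => i; rewrite !ffunE permM. Qed.

Lemma vset_perm k (s : 'S_k.+1) (x : osimplex G k) :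
  vset (osimplex_perm s x) = vset x.
Proof.
apply/setP => v; apply/imsetP/imsetP => -[i _ ->].
  by exists (s i); rewrite ?ffunE.
by exists (s^-1%g i); rewrite // ffunE permKV.
Qed.

Lemma vset_map (T : endo G) k (x : osimplex G k) :
  vset (osimplex_map T x) = T @: vset x.
Proof.
by rewrite /vset -imset_comp; apply: eq_imset => i; rewrite /= ffunE.
Qed.

Lemma card_osimplex_vset k (y : {set G}) :
  is_simplex y -> #|y| = k.+1 ->
  #|[set x : osimplex G k | vset x == y]| = (k.+1)`!.
Proof.
move=> /andP[_ /'forall_implyP y_adj] card_y.
rewrite -(card_imset _ val_inj) /=.
transitivity #|[set f : {ffun 'I_k.+1 -> G} in ffun_on (mem y) | injectiveb f]|.
  apply: eq_card => f; rewrite !inE; apply/imsetP/andP.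
    case=> x; rewrite inE => /eqP <- ->; split.
      by apply/ffun_onP => i; apply: imset_f.
    exact/injectiveP/osimplex_inj.
  case=> /ffun_onP fy /injectiveP f_inj.
  have fP : is_osimplex f.
    apply/'forall_'forall_implyP => i j ij.
    have /'forall_implyP/(_ _ (fy j))/implyP := y_adj _ (fy i); apply.
    by rewrite (inj_eq f_inj).
  exists (Sub f fP : osimplex G k); last by rewrite SubK.
  rewrite inE eqEcard card_vset card_y leqnn andbT.
  by apply/subsetP => _ /imsetP[i _ ->]; rewrite SubK; apply: fy.
by rewrite card_inj_ffuns_on card_y card_ord ffactnn.
Qed.

(** The sum has at most one term, as the vertices of x are distinct. *)
Lemma sum_perm_fixed (F : fieldType) (T : endo G) k (x : osimplex G k) :
  \sum_(s : 'S_k.+1 | osimplex_perm s (osimplex_map T x) == x) (-1) ^+ s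
  = if T @: vset x == vset x then (-1) ^+ odd_perm (simplex_perm T (vset x))
    else 0 :> F.
Proof.
case: eqP => [Tx | nTx]; last first.
  apply: big_pred0 => s; apply/negP => /eqP/(congr1 (@vset k)).
  by rewrite vset_perm vset_map.
pose f i : {v : G | v \in vset x} :=
  Sub (val x i) (imset_f _ (erefl (i \in predT))).
have bij_f : bijective f.
  apply: inj_card_bij => [i j /(congr1 val)/osimplex_inj //|].
  by rewrite card_sig card_vset card_ord.
(* T permutes the vertices of x: T (x i) = x (t i) with t conjugate to the
   permutation of T on their set.  The only solution s is the inverse of t. *)
have [t tE <-] := perm_transport (simplex_perm T (vset x)) bij_f.
have Tt i : T (val x i) = val x (t i).
  have /(congr1 val) := tE i; rewrite simplex_permE // => /esym; exact.
rewrite (big_pred1 t^-1%g) ?odd_permV // => s /=.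
apply/eqP/eqP => [sx | ->].
  apply/permP => i; apply: (@perm_inj _ t); rewrite permKV.
  apply: (osimplex_inj (x := x)); rewrite -Tt.
  by have := congr1 (fun z : osimplex G k => val z i) sx; rewrite /= !ffunE.
by apply/val_inj/ffunP => i; rewrite !ffunE Tt permKV.
Qed.

End OrientedSimplices.

(** * The trace of the pull-back on forms *)

Section Alternation.
Variables (F : fieldType) (G : sgraph).

(** Alternation: the average over the reorderings s of the arguments of f,
    each weighted by the sign of s. *)
Definition alternate k (f : cochain F G k) : cochain F G k :=
  [ffun x => ((k.+1)`!)%:R^-1 *
     \sum_(s : 'S_k.+1) (-1) ^+ s * f (osimplex_perm s x)].

Fact alternate_is_linear k : linear (@alternate k).
Proof.
move=> a f g; apply/ffunP => x; rewrite !ffunE /GRing.scale /= mulrCA -mulrDr.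
congr (_ * _); rewrite mulr_sumr -big_split; apply: eq_bigr => s _ /=.
by rewrite !ffunE mulrDr mulrCA.
Qed.

HB.instance Definition _ k := GRing.isSemilinear.Build F _ _ _
  (@alternate k) (GRing.semilinear_linear (@alternate_is_linear k)).

Lemma alternate_antisym k (f : cochain F G k) :
  alternate f \in antisym_space F G k.
Proof.
apply/antisym_spaceP => i j x ij; rewrite !ffunE -mulrN; congr (_ * _).
rewrite [in RHS](reindex_inj (mulIg (tperm i j))) /= -sumrN.
apply: eq_bigr => s _; rewrite osimplex_permM odd_permM odd_tperm ij.
by rewrite signr_addb expr1 mulrN1 mulNr opprK.
Qed.

Hypothesis F0 : [pchar F] =i pred0.

Let fact_neq0 k : ((k.+1)`!)%:R != 0 :> F.
Proof. by have /pcharf0P -> := F0; rewrite -lt0n fact_gt0. Qed.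

Lemma alternate_id k (f : cochain F G k) :
  f \in antisym_space F G k -> alternate f = f.
Proof.
move=> fA; apply/ffunP => x; rewrite ffunE.
under eq_bigr do rewrite antisym_perm // mulrA -signr_addb addbb mul1r.
by rewrite sumr_const card_Sn -[f x *+ _]mulr_natl mulKf ?fact_neq0.
Qed.

(** With i the inclusion of forms in cochains and p the alternation,
    p i = 1, so the trace of T* on forms is that of i T* p on cochains. *)
Lemma lftrace_pull_form (T : endo G) k :
  lftrace (linfun (@pull_form F G T k)) =
  \sum_(y in fixed_simplices T | sdim y == k)
    (-1) ^+ odd_perm (simplex_perm T y).
Proof.
pose i : 'Hom(kform F G k, cochain F G k) := linfun vsval.
pose p : 'Hom(cochain F G k, kform F G k) :=
  (linfun (vsproj _) \o linfun (@alternate k))%VF.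
have pi1 : (p \o i = \1)%VF.
  apply/lfunP => f; rewrite !lfun_simp /= alternate_id ?subvsP //.
  exact: vsvalK.
rewrite -[linfun _]comp_lfun1r -pi1 comp_lfunA lftrace_comp comp_lfunA.
rewrite lftrace_ffun.
rewrite (eq_bigr (fun x : osimplex G k => ((k.+1)`!)%:R^-1 *
  if T @: vset x == vset x then (-1) ^+ odd_perm (simplex_perm T (vset x))
  else 0));
  last first.
  move=> x _; rewrite !lfun_simp /= ffunE vsprojK ?alternate_antisym //.
  rewrite ffunE -sum_perm_fixed; congr (_ * _); rewrite [RHS]big_mkcond /=.
  apply: eq_bigr => s _; rewrite ffunE.
  by case: eqP => _; rewrite ?mulr1 ?mulr0.
rewrite -mulr_sumr -big_mkcond /=.
rewrite (partition_big (@vset G k)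
  (fun y => (y \in fixed_simplices T) && (sdim y == k))) /=.
  rewrite mulr_sumr; apply: eq_bigr => y /andP[].
  rewrite inE => /andP[yS /eqP Ty] /eqP dy.
  have card_y : #|y| = k.+1.
    by case/andP: yS; rewrite -card_gt0 -dy /sdim => /prednK.
  rewrite (eq_bigr (fun=> (-1) ^+ odd_perm (simplex_perm T y))); last first.
    by move=> x /andP[_ /eqP->].
  rewrite sumr_const.
  rewrite (_ : #|_| = (k.+1)`!).
    by rewrite -[(-1) ^+ _ *+ _]mulr_natl mulKf.
  rewrite -(card_osimplex_vset yS card_y); apply: eq_card => x.
  rewrite !inE unfold_in.
  by case: (vset x =P y) => [->|_]; rewrite ?andbF // Ty eqxx.
by move=> x Tx; rewrite inE vset_simplex Tx /sdim card_vset /=.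
Qed.

End Alternation.

(** * The square of the exterior derivative *)

Section Complex.
Variables (F : fieldType) (G : sgraph).

(** Deleting the vertices i and then j < i is deleting j and then i, which has
    become number i - 1. *)
Lemma face_face k (x : osimplex G k.+2) (i : 'I_k.+3) (j : 'I_k.+2) :
  (j < i)%N -> face j (face i x) = face (inord i.-1) (face (inord j) x).
Proof.
move=> ji; apply/val_inj/ffunP => l; rewrite !ffunE; congr (val x _).
have i_lt : (i.-1 < k.+2)%N by have := ltn_ord i; case: (nat_of_ord i) ji.
apply/val_inj; rewrite /= !inordK ?(ltn_trans ji) // bumpC.
rewrite /unbump ji subn1; congr (bump _ _).
by rewrite /bump leqNgt ji.
Qed.

(** The terms (i, j) with j < i cancel against those with j >= i under
    the bijection (i, j) |-> (j, i - 1), by [face_face]. *)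
Lemma dcochainK k (f : cochain F G k) : dcochain (dcochain f) = 0.
Proof.
apply/ffunP => x; rewrite !ffunE.
pose t (ij : 'I_k.+3 * 'I_k.+2) : F :=
  (-1) ^+ ij.1 * ((-1) ^+ ij.2 * f (face ij.2 (face ij.1 x))).
transitivity (\sum_ij t ij).
  rewrite -(pair_big xpredT xpredT (fun i j => t (i, j))) /=.
  apply: eq_bigr => i _.
  by rewrite ffunE mulr_sumr.
rewrite (bigID (fun ij : 'I_k.+3 * 'I_k.+2 => (ij.2 < ij.1)%N)) /=.
(* The bijection and its inverse; on pairs with j >= i the inverse is
   (i, j) |-> (j + 1, i). *)
pose sw (ij : 'I_k.+3 * 'I_k.+2) : 'I_k.+3 * 'I_k.+2 :=
  (inord ij.2, inord ij.1.-1).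
pose ws (ij : 'I_k.+3 * 'I_k.+2) : 'I_k.+3 * 'I_k.+2 :=
  (inord ij.2.+1, inord ij.1).
rewrite [X in _ + X](reindex_onto sw ws) /= => [|[i j] /=]; last first.
  rewrite -leqNgt => ij; congr pair; apply/val_inj => /=.
    have i_lt := leq_ltn_trans ij (ltn_ord j).
    by rewrite (inordK i_lt) inordK // ltnW.
  have j_lt : (j.+1 < k.+3)%N := ltn_ord j.
  by rewrite (inordK j_lt) inordK.
rewrite [X in _ + X](eq_bigl (fun ij : 'I_k.+3 * 'I_k.+2 => (ij.2 < ij.1)%N)).
  rewrite -big_split big1 //= => -[i j] /= ji; rewrite /t /= (face_face _ ji).
  have i_lt : (i.-1 < k.+2)%N by have := ltn_ord i; case: (nat_of_ord i) ji.
  have j_lt : (j < k.+3)%N by rewrite ltnW // ltnS ltn_ord.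
  rewrite !inordK // !mulrA -mulrDl -!exprD.
  have -> : (i + j = (j + i.-1).+1)%N.
    by rewrite -addnS prednK ?(leq_ltn_trans _ ji) // addnC.
  by rewrite exprS mulN1r addNr mul0r.
move=> [i j] /=; rewrite xpair_eqE -!val_eqE /=.
have i_lt : (i.-1 < k.+2)%N.
  by have := ltn_ord i; case: (nat_of_ord i) => //= m /ltnW.
have j_lt : (j < k.+3)%N by rewrite ltnW // ltnS ltn_ord.
rewrite !inordK // -leqNgt.
case: ltnP => [ji|ij].
  have i_gt0 := leq_ltn_trans (leq0n j) ji.
  by rewrite prednK // !eqxx -ltnS prednK // ji.
apply/negbTE/negP => /andP[ji /andP[/eqP iE _]].
by move: ij; rewrite -iE ltnNge ji.
Qed.

Lemma dformK k (f : kform F G k) : dform (dform f) = 0.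
Proof. by apply/val_inj; rewrite /= dcochainK. Qed.

Lemma exact_closed k (f : kform F G k) :
  f \in exact_form F G k -> f \in closed_form F G k.
Proof.
case: k f => [|k] f /=; first by rewrite memv0 => /eqP->; apply: mem0v.
by case/memv_imgP => g _ ->; rewrite memv_ker !lfunE /= dformK.
Qed.

End Complex.

(** * The Hopf trace formula *)

Section HopfTrace.
Variables (F : fieldType) (G : sgraph) (T : endo G).

Fact pull_closed_form_is_linear k : linear (@pull_closed_form F G T k).
Proof. by move=> a f g; apply/val_inj; rewrite /= linearP. Qed.

HB.instance Definition _ k := GRing.isSemilinear.Build F _ _ _
  (@pull_closed_form F G T k)
  (GRing.semilinear_linear (@pull_closed_form_is_linear k)).

Let Z k : vectType F := subvs_of (closed_form F G k).
Let B k : vectType F := subvs_of (exact_in_closed F G k).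

Lemma pull_exact_in_closed k (f : Z k) :
  f \in exact_in_closed F G k -> pull_closed_form T f \in exact_in_closed F G k.
Proof. by rewrite -!memv_preim !lfunE; apply: pull_exact. Qed.

(** The pull-back on the exact k-forms, seen as a subspace of the closed
    k-forms. *)
Definition pull_exact_form k : 'End(B k) :=
  (linfun (vsproj _) \o linfun (@pull_closed_form F G T k) \o linfun vsval)%VF.

Lemma pull_exact_formE k (f : B k) :
  vsval (pull_exact_form k f) = pull_closed_form T (vsval f).
Proof.
by rewrite !lfun_simp /= vsprojK // pull_exact_in_closed // subvsP.
Qed.

(** The sequence B^k -> Z^k -> H^k. *)
Lemma lftrace_closed k :
  lftrace (linfun (@pull_closed_form F G T k)) =
  lftrace (pull_exact_form k) + lftrace (induced F T k).
Proof.
apply: (@lftrace_exact F (B k) (Z k) _ (linfun vsval)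
  (linfun (quotv_pi (exact_in_closed F G k)))).
- exact: lker_vsval.
- apply/vspaceP => u; rewrite memvf; apply/memv_imgP.
  by exists (quotv_repr u); rewrite ?memvf // lfunE /= quotv_reprK.
- rewrite limg_vsval; apply/vspaceP => f.
  rewrite memv_ker lfunE /= -(linear0 (quotv_pi (exact_in_closed F G k))).
  by rewrite eq_quotv subr0.
- apply/lfunP => f; rewrite [LHS]comp_lfunE [RHS]comp_lfunE [RHS]lfunE.
  by rewrite [RHS]pull_exact_formE !lfunE.
apply/lfunP => f; rewrite !comp_lfunE !lfunE /=; exact/esym/pull_classE.
Qed.

(** The sequence Z^k -> C^k -> B^(k+1) given by the exterior derivative. *)
Lemma lftrace_form k :
  lftrace (linfun (@pull_form F G T k)) =
  lftrace (linfun (@pull_closed_form F G T k)) + lftrace (pull_exact_form k.+1).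
Proof.
pose p : 'Hom(kform F G k, B k.+1) :=
  (linfun (vsproj _) \o linfun (vsproj _) \o linfun (@dform F G k))%VF.
have pE f : vsval (vsval (p f)) = dform f.
  have d_exact : dform f \in exact_form F G k.+1.
    by apply/memv_imgP; exists f; rewrite ?memvf ?lfunE.
  rewrite !lfun_simp /= !vsprojK //; first exact: exact_closed.
  by rewrite -memv_preim lfunE /= vsprojK // exact_closed.
apply: (@lftrace_exact F (Z k) _ _ (linfun vsval) p).
- exact: lker_vsval.
- apply/vspaceP => u; rewrite memvf; apply/memv_imgP.
  have := subvsP u; rewrite -memv_preim lfunE /= => /memv_imgP[g _].
  rewrite lfunE /= => uE.
  exists g; rewrite ?memvf //; apply/val_inj/val_inj.
  by rewrite -[RHS]/(vsval (vsval (p g))) pE -uE.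
- rewrite limg_vsval; apply/vspaceP => f.
  rewrite !memv_ker [X in _ = (X == _)]lfunE /= -pE.
  by rewrite -!(inj_eq val_inj).
- by apply/lfunP => f; rewrite !comp_lfunE !lfunE.
apply/lfunP => f; apply/val_inj/val_inj.
rewrite [X in val (val X) = _]comp_lfunE [X in _ = val (val X)]comp_lfunE.
rewrite -[LHS]/(vsval (vsval (p _))).
rewrite -[RHS]/(vsval (vsval (pull_exact_form k.+1 (p f)))).
by rewrite pE pull_exact_formE lfunE /= pE pull_dform.
Qed.

(** The Hopf trace formula. *)
Lemma lefschetz_forms :
  lefschetz F T =
  \sum_(k < #|G|) (-1) ^+ k * lftrace (linfun (@pull_form F G T k)).
Proof.
pose b k := lftrace (pull_exact_form k).
have b0 : b 0%N = 0.
  apply: lftrace_trivial => f; apply/val_inj/val_inj => /=; apply/eqP.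
  by have := subvsP f; rewrite -memv_preim lfunE memv0.
have bn : b #|G| = 0.
  apply: lftrace_trivial => f; do 3!apply/val_inj; apply/ffunP => x /=.
  by have := osimplex_dim x; rewrite ltnn.
pose u k := (-1) ^+ k * b k.
transitivity (
  \sum_(k < #|G|) (-1) ^+ k * lftrace (linfun (@pull_form F G T k)) +
  \sum_(0 <= k < #|G|) (u k.+1 - u k)).
  rewrite big_mkord -big_split; apply: eq_bigr => k _ /=.
  rewrite lftrace_form lftrace_closed /u exprS mulN1r mulNr -/(b k) -/(b k.+1).
  by rewrite !mulrDr addrA addrK addrAC subrr add0r.
by rewrite telescope_sumr // /u b0 bn !mulr0 subrr addr0.
Qed.

Hypothesis F0 : [pchar F] =i pred0.

(** The Lefschetz formula over any field of characteristic 0. *)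
Lemma lefschetz_fixed_simplices :
  lefschetz F T = \sum_(y in fixed_simplices T) (fixed_index T y)%:~R.
Proof.
rewrite lefschetz_forms.
under eq_bigr do rewrite (lftrace_pull_form F0) mulr_sumr.
rewrite (exchange_big_dep (mem (fixed_simplices T))) /= => [|k y _ /andP[] //].
apply: eq_bigr => y yF.
have y_gt0 : (0 < #|y|)%N by move: yF; rewrite inE card_gt0 => /andP[/andP[]].
have dim_y : (sdim y < #|G|)%N by rewrite /sdim prednK // max_card.
rewrite (big_pred1 (Ordinal dim_y)) /= => [|k].
  by rewrite /fixed_index rmorphM /= !rmorphXn /= rmorphN1.
by rewrite yF /= eq_sym -val_eqE.
Qed.

End HopfTrace.

Theorem theorem3p1 (R : realType) (G : sgraph) (T : endo G) :
  lefschetz R T = \sum_(x in fixed_simplices T) (fixed_index T x)%:~R.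
Proof. exact/lefschetz_fixed_simplices/Num.Theory.pchar_num. Qed.
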